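(* Let $d \ge 1$, let $A \subseteq \mathbb{R}^d$ be finite and generic, let $k \ge 0$ be an integer, and let $a \in A$. Then every $x \in \mathbb{R}^d$ that is generic with respect to $A$ is contained in at most $\binom{d+k}{d}$ $k$-hefty simplices of $A$, with equality if and only if $x \in \mathrm{Hull}_k(A)$. Moreover, there is $\varepsilon>0$ such that every $x$ generic with respect to $A$ with $\|x-a\|<\varepsilon$ is contained in at most $\binom{d+k-1}{d-1}$ $k$-hefty simplices of $A$ having $a$ as a vertex.
   Context: $A$ is generic if no $d+1$ of its points lie on a common affine hyperplane and no $d+2$ of its points lie on a common $(d-1)$-sphere. For generic $A$, any $d+1$ of its points span a $d$-simplex with a unique circumscribed $(d-1)$-sphere; a point is inside a sphere if it lies in the interior of the closed ball bounded by it. A $d$-simplex with vertices in $A$ is $k$-hefty if exactly $k$ points of $A$ lie inside its circumscribed sphere. A point $x$ is generic with respect to $A$ if $x \notin A$ and $A \cup \{x\}$ is generic. The $k$-hull $\mathrm{Hull}_k(A)$ is the intersection of all closed half-spaces of $\mathbb{R}^d$ that miss at most $k$ points of $A$.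
   Formalization: The equality criterion is stated only for sets A with at least d points; for smaller A it can fail (d = 3, k = 0, A two points, x their midpoint: x lies in the hull but there are no simplices). Both upper bounds are stated without restriction. *)

(* Defs.v *)
From HB Require Import structures.
From mathcomp Require Import all_boot all_order all_algebra.
From mathcomp Require Import finmap.
From mathcomp Require Import all_classical all_reals.
From mathcomp Require Import topology normedtype.
Set Implicit Arguments.
Unset Strict Implicit.
Unset Printing Implicit Defensive.
Import Order.TTheory GRing.Theory Num.Theory.
Import numFieldNormedType.Exports.

Local Open Scope ring_scope.
Local Open Scope classical_set_scope.
Local Open Scope fset_scope.

Section Definitions.
Variables (R : realType) (d : nat).
Local Notation point := 'rV[R]_d.
Implicit Types (x u c : point) (A S : {fset point}) (k : nat) (H : set point).

Definition dot x u : R := \sum_(i < d) x ord0 i * u ord0 i.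

(* The norm that the library puts on 'rV[R]_d is the sup norm, so the Euclidean
   norm is defined here. Both induce the topology of 'rV[R]_d. *)
Definition enorm x : R := Num.sqrt (dot x x).

Definition sphere c (r : R) : set point := [set y | enorm (y - c) = r].

Definition cball c (r : R) : set point := [set y | enorm (y - c) <= r].

Definition on_common_hyperplane S : Prop :=
  exists u (b : R), u != 0 /\ forall p, p \in S -> dot u p = b.

Definition circumsphere S c (r : R) : Prop :=
  0 < r /\ forall p, p \in S -> sphere c r p.

Definition on_common_sphere S : Prop :=
  exists c (r : R), circumsphere S c r.

Definition generic A : Prop :=
  (forall S, S `<=` A -> #|` S| = d.+1 -> ~ on_common_hyperplane S) /\
  (forall S, S `<=` A -> #|` S| = d.+2 -> ~ on_common_sphere S).

Definition generic_wrt A x : Prop := x \notin A /\ generic (x |` A).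

Definition affinely_independent S : Prop :=
  forall w : point -> R,
    \sum_(p <- S) w p = 0 -> \sum_(p <- S) w p *: p = 0 ->
    forall p, p \in S -> w p = 0.

(* A d-simplex is represented by the finite set of its d+1 vertices. *)
Definition simplex_of A S : Prop :=
  [/\ (S `<=` A)%fset, #|` S| = d.+1 & affinely_independent S].

Definition conv S : set point :=
  [set x | exists w : point -> R,
     [/\ forall p, p \in S -> 0 <= w p,
         \sum_(p <- S) w p = 1 & x = \sum_(p <- S) w p *: p]].

Definition points_inside A c (r : R) : {fset point} :=
  [fset p in A | `[< interior (cball c r) p >]].

(* The circumscribed sphere of a d-simplex exists and is unique, so the
   existential quantifier below speaks of that sphere. *)
Definition hefty A k S : Prop :=
  simplex_of A S /\
  exists c (r : R), circumsphere S c r /\ #|` points_inside A c r| = k.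

Definition hefty_simplices_containing A k x : {fset {fset point}} :=
  [fset S in fpowerset A | `[< hefty A k S /\ conv S x >]].

Definition closed_halfspace H : Prop :=
  exists u (b : R), u != 0 /\ H = [set y | dot u y <= b].

Definition hull A k : set point :=
  (\bigcap_(H in [set H | closed_halfspace H /\
     (#|` [fset p in A | p \notin H]| <= k)%N]) H)%classic.

End Definitions.

(* Main.v *)
(* Lift the points to the paraboloid. The k-hefty simplices containing x become
   the bases S of the linear program [min sum w_p z_p, sum w_p (1, p) = (1, x),
   w >= 0] that have exactly k lifted points below the hyperplane spanned by S.
   Every vertex set Q whose hull contains x has exactly one optimal basis, so the
   sums over S of the binomials C(#above S, j) count such sets Q and do not depend
   on the heights z; hence neither does h_k, the number of bases with k points
   below. Lifting a point i very high gives h_k(A \ i) <= h_k(A), and double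
   counting gives McMullen's recurrence
     sum_i h_k(A \ i) + (d + 1 + k) h_k = (k + 1) h_(k+1) + |A| h_k.
   Therefore (k + 1) h_(k+1) <= (d + 1 + k) h_k and h_k <= C(d + k, k), with
   equality iff x lies in the hull of A minus any k points; Farkas' lemma
   identifies this with the k-hull. For the simplices with vertex a the same
   count is applied to the vectors p - a with heights |p - a|^2, in one dimension
   less; in both cases the power of p with respect to a sphere is the height of p
   minus a linear form. *)
Require Import Defs.
From mathcomp Require Import all_boot all_order all_algebra.
From mathcomp Require Import finmap.
From mathcomp Require Import all_classical all_reals.
From mathcomp Require Import topology normedtype.
From mathcomp Require Import ring lra zify.
Set Implicit Arguments.
Unset Strict Implicit.
Unset Printing Implicit Defensive.
Import Order.TTheory GRing.Theory Num.Theory.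
Import numFieldNormedType.Exports.

Local Open Scope ring_scope.

Lemma coef_exprXD1 (n j : nat) : (('X + 1) ^+ n : {poly int})`_j = 'C(n, j)%:R.
Proof.
have -> : ('X + 1) ^+ n = \poly_(i < n.+1) ('C(n, i)%:R : int).
  rewrite addrC exprDn poly_def; apply: eq_bigr => i _.
  by rewrite expr1n mul1r scaler_nat.
by rewrite coef_poly ltnS; case: leqP => // /bin_small ->.
Qed.

Lemma perm_eq_binomial_moments (s t : seq nat) :
  (forall j, \sum_(n <- s) 'C(n, j) = \sum_(n <- t) 'C(n, j))%N -> perm_eq s t.
Proof.
move=> st; pose gen (r : seq nat) (q : {poly int}) := \sum_(n <- r) q ^+ n.
have genX1 : gen s ('X + 1) = gen t ('X + 1).
  have coef_gen r j : (gen r ('X + 1))`_j = (\sum_(n <- r) 'C(n, j))%:R.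
    by rewrite coef_sum natr_sum; apply: eq_bigr => n _; rewrite coef_exprXD1.
  by apply/polyP => j; rewrite !coef_gen st.
have genX : gen s 'X = gen t 'X.
  have shift_gen r : gen r 'X = gen r ('X + 1) \Po ('X - 1).
    rewrite raddf_sum; apply: eq_bigr => n _ /=.
    by rewrite rmorphXn rmorphD rmorph1 /= comp_polyX subrK.
  by rewrite !shift_gen genX1.
have coef_gen r k : (gen r 'X)`_k = (count_mem k r)%:R.
  rewrite coef_sum -sum1_count natr_sum [RHS]big_mkcond.
  by apply: eq_bigr => n _; rewrite coefXn eq_sym /=; case: eqP.
apply/allP => k _; apply/eqP/(@mulrIn int 1); first exact: oner_neq0.
by rewrite -!coef_gen genX.
Qed.

Lemma sum_card_incidences (I J : finType) (A : {set I}) (B : {set J})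
    (r : I -> J -> bool) :
  (\sum_(i in A) #|[set j in B | r i j]| =
   \sum_(j in B) #|[set i in A | r i j]|)%N.
Proof.
have sum1r (K : finType) (C : {set K}) (P : pred K) :
    #|[set k in C | P k]| = (\sum_(k in C | P k) 1)%N.
  by rewrite sum1_card; apply: eq_card => k; rewrite inE.
under eq_bigr do rewrite sum1r big_mkcondr.
by rewrite exchange_big; apply: eq_bigr => j _; rewrite sum1r big_mkcondr.
Qed.

Lemma mul_binSr m k : (k.+1 * 'C(m + k.+1, k.+1) = (m.+1 + k) * 'C(m + k, k))%N.
Proof. by rewrite addnS -mul_bin_diag addSn. Qed.

Lemma exists_superset (T : finType) (B : {set T}) n :
  (#|B| <= n <= #|T|)%N -> exists2 S : {set T}, B \subset S & #|S| = n.
Proof.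
case/andP=> cardB cardT.
have /card_gt0P[X] :
    (0 < #|[set X : {set T} | X \subset ~: B & #|X| == (n - #|B|)%N]|)%N.
  by rewrite cards_draws bin_gt0; have := cardsC B; lia.
rewrite inE => /andP[XB /eqP cardX]; exists (B :|: X); first exact: finset.subsetUl.
have /disjoint_setI0 BX : [disjoint B & X].
  by rewrite disjoint_sym finset.disjoints_subset.
by rewrite cardsU BX cards0 cardX subn0 subnKC.
Qed.

Lemma exists_left_kernel (F : fieldType) p q (M : 'M[F]_(p, q)) :
  (q < p)%N -> exists2 r : 'rV_p, r != 0 & r *m M = 0.
Proof.
move=> qp; have : kermx M != 0.
  rewrite -mxrank_eq0 mxrank_ker subn_eq0 -ltnNge.
  exact: leq_ltn_trans (rank_leq_col M) qp.
by case/rowV0Pn=> r /sub_kermxP rM r0; exists r.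
Qed.

Section DotProduct.
Variables (R : realType) (d : nat).
Implicit Types (x y u : 'rV[R]_d) (b : R).

Lemma dotC x u : dot x u = dot u x.
Proof. by apply: eq_bigr => i _; rewrite mulrC. Qed.

Lemma dotDl x y u : dot (x + y) u = dot x u + dot y u.
Proof. by rewrite -big_split; apply: eq_bigr => i _; rewrite mxE mulrDl. Qed.

Lemma dotZl b x u : dot (b *: x) u = b * dot x u.
Proof. by rewrite /dot mulr_sumr; apply: eq_bigr => i _; rewrite mxE mulrA. Qed.

Lemma dotZr b u x : dot u (b *: x) = b * dot u x.
Proof. by rewrite !(dotC u) dotZl. Qed.

Lemma dot0l u : dot 0 u = 0.
Proof. by rewrite -[0](scale0r u) dotZl mul0r. Qed.

Lemma dotBl x y u : dot (x - y) u = dot x u - dot y u.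
Proof. by rewrite dotDl -scaleN1r dotZl mulN1r. Qed.

Lemma dotBr u x y : dot u (x - y) = dot u x - dot u y.
Proof. by rewrite !(dotC u) dotBl. Qed.

Lemma dot_suml I (s : seq I) (P : pred I) (f : I -> 'rV[R]_d) u :
  dot (\sum_(i <- s | P i) f i) u = \sum_(i <- s | P i) dot (f i) u.
Proof. by elim/big_rec2: _ => [|i a b _ <-]; [exact: dot0l | exact: dotDl]. Qed.

Lemma dot_sumr I (s : seq I) (P : pred I) (f : I -> 'rV[R]_d) u :
  dot u (\sum_(i <- s | P i) f i) = \sum_(i <- s | P i) dot u (f i).
Proof. by rewrite dotC dot_suml; apply: eq_bigr => i _; rewrite dotC. Qed.

Lemma dotxx_ge0 x : 0 <= dot x x.
Proof. by apply: sumr_ge0 => i _; rewrite -expr2 sqr_ge0. Qed.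

Lemma dotxx_eq0 x : (dot x x == 0) = (x == 0).
Proof.
apply/eqP/eqP => [x0|->]; last exact: dot0l.
apply/rowP => i; rewrite mxE; apply/eqP; rewrite -sqrf_eq0 expr2; apply/eqP.
by apply: (psumr_eq0P _ x0) => // j _; rewrite -expr2 sqr_ge0.
Qed.

Lemma dotxx_gt0 x : (0 < dot x x) = (x != 0).
Proof. by rewrite lt_neqAle dotxx_ge0 andbT eq_sym dotxx_eq0. Qed.

Lemma dotBB x y : dot (x - y) (x - y) = dot x x - 2 * dot y x + dot y y.
Proof. by rewrite dotBl !dotBr (dotC x y); ring. Qed.

End DotProduct.

Lemma dot_row_mx (R : realType) (m n : nat) (x y : 'rV[R]_m) (p q : 'rV[R]_n) :
  dot (row_mx x p) (row_mx y q) = dot x y + dot p q.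
Proof.
rewrite /dot big_split_ord; congr (_ + _).
  by apply: eq_bigr => i _; rewrite !row_mxEl.
by apply: eq_bigr => i _; rewrite !row_mxEr.
Qed.

Section VectorFamilies.
Variables (R : realType) (n : nat) (T : finType) (v : T -> 'rV[R]_n).
Implicit Types (S Q : {set T}) (x u : 'rV[R]_n) (z w l : T -> R).

Definition spanning S : Prop :=
  forall u, (forall p, p \in S -> dot u (v p) = 0) -> u = 0.

Definition general_position : Prop := forall S, #|S| = n -> spanning S.

Definition family_mx S : 'M[R]_(#|S|, n) := \matrix_(i < #|S|) v (enum_val i).

Lemma sum_family_mx S w :
  \sum_(p in S) w p *: v p = (\row_i w (enum_val i)) *m family_mx S.
Proof.
rewrite mulmx_sum_row big_enum_val; apply: eq_bigr => i _.
by rewrite mxE rowK.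
Qed.

Lemma mul_tr_family_mx S u :
  u *m (family_mx S)^T = \row_i dot u (v (enum_val i)).
Proof. by apply/rowP => i; rewrite !mxE; apply: eq_bigr => j _; rewrite !mxE. Qed.

Lemma row_enum_val_inj S z z' :
  \row_(i < #|S|) z (enum_val i) = \row_(i < #|S|) z' (enum_val i) ->
  forall p, p \in S -> z p = z' p.
Proof.
move=> /rowP row_eq p pS; have := row_eq (enum_rank_in pS p).
by rewrite !mxE enum_rankK_in.
Qed.

Lemma exists_row_enum_val S (r : 'rV[R]_#|S|) :
  exists w, r = \row_i w (enum_val i).
Proof.
exists (fun p => \sum_(i | enum_val i == p) r 0 i); apply/rowP => j.
by rewrite mxE (big_pred1 j) // => i; rewrite (inj_eq enum_val_inj).
Qed.

Lemma orthogonal_family_mx S u :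
  u *m (family_mx S)^T = 0 -> forall p, p \in S -> dot u (v p) = 0.
Proof.
rewrite mul_tr_family_mx => u0; apply: (row_enum_val_inj (z' := fun=> 0)).
by rewrite u0; apply/rowP => i; rewrite !mxE.
Qed.

Lemma rank_family_mx S : spanning S -> \rank (family_mx S) = n.
Proof.
move=> S_span; rewrite -mxrank_tr; apply/eqP.
by apply: inj_row_free => u /orthogonal_family_mx /S_span.
Qed.

Lemma spanning_sum S x : spanning S -> exists w, x = \sum_(p in S) w p *: v p.
Proof.
move=> /rank_family_mx Sn.
have /submxP[r ->] : (x <= family_mx S)%MS by rewrite submx_full ?/row_full ?Sn.
by have [w ->] := exists_row_enum_val r; exists w; rewrite sum_family_mx.
Qed.

Lemma exists_linear_form S z : #|S| = n -> spanning S ->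
  exists u, forall p, p \in S -> dot u (v p) = z p.
Proof.
move=> cardS /rank_family_mx Sn.
have /submxP[u zE] : (\row_(i < #|S|) z (enum_val i) <= (family_mx S)^T)%MS.
  by rewrite submx_full // /row_full mxrank_tr Sn cardS.
by exists u; apply: (row_enum_val_inj (z := dot u \o v)); rewrite -mul_tr_family_mx.
Qed.

Lemma exists_linear_relation Q : (n < #|Q|)%N ->
  exists2 l, \sum_(p in Q) l p *: v p = 0 & exists2 p, p \in Q & l p != 0.
Proof.
move=> /(exists_left_kernel (family_mx Q))[r r0 rQ].
have [l rE] := exists_row_enum_val r.
exists l; first by rewrite sum_family_mx -rE.
have [i ri] : exists i, r 0 i != 0 by exact/rV0Pn.
by exists (enum_val i); [exact: enum_valP | move: ri; rewrite rE mxE].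
Qed.

Lemma exists_orthogonal S : (#|S| < n)%N ->
  exists2 u, u != 0 & forall p, p \in S -> dot u (v p) = 0.
Proof.
move=> /(exists_left_kernel (family_mx S)^T)[u u0 /orthogonal_family_mx uS].
by exists u.
Qed.

(* The linear form whose graph passes through the lifted points [(v p, z p)]
   with [p] in [S]; it is the junk value [0] if there is no such form. *)
Definition interp z S : 'rV[R]_n :=
  xget 0 [set u | forall p, p \in S -> dot u (v p) = z p]%classic.

Definition dual_basis S p : 'rV[R]_n := interp (fun q => (q == p)%:R) S.

Definition basis_coord S p x : R := dot (dual_basis S p) x.

Section Basis.
Variable S : {set T}.
Hypotheses (cardS : #|S| = n) (S_span : spanning S).

Lemma dot_interp z p : p \in S -> dot (interp z S) (v p) = z p.
Proof.
have [u uP] := exists_linear_form z cardS S_span.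
pose forms := [set u | forall p, p \in S -> dot u (v p) = z p]%classic.
by move: p; apply: (@xgetPex _ 0 forms); exists u.
Qed.

Lemma dot_dual_basis p q : q \in S -> dot (dual_basis S p) (v q) = (q == p)%:R.
Proof. exact: dot_interp. Qed.

Lemma interp_unique z u :
  (forall p, p \in S -> dot u (v p) = z p) -> interp z S = u.
Proof.
move=> uP; apply/eqP; rewrite -subr_eq0; apply/eqP/S_span => p pS.
by rewrite dotBl uP // dot_interp // subrr.
Qed.

Lemma basis_coord_sum l p : p \in S ->
  basis_coord S p (\sum_(q in S) l q *: v q) = l p.
Proof.
move=> pS; rewrite /basis_coord dot_sumr (bigD1 p) //= dotZr dot_dual_basis //.
rewrite eqxx mulr1 big1 ?addr0 // => q /andP[qS /negPf qp].
by rewrite dotZr dot_dual_basis // qp mulr0.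
Qed.

Lemma sum_basis_coord x : \sum_(p in S) basis_coord S p x *: v p = x.
Proof.
have [w xE] := spanning_sum x S_span.
by rewrite [RHS]xE; apply: eq_bigr => p pS; rewrite xE basis_coord_sum.
Qed.

Lemma dot_basis_coord u x :
  dot u x = \sum_(p in S) basis_coord S p x * dot u (v p).
Proof.
rewrite -{1}(sum_basis_coord x) dot_sumr.
by apply: eq_bigr => p _; rewrite dotZr.
Qed.

Lemma dot_interp_sum z x :
  dot (interp z S) x = \sum_(p in S) basis_coord S p x * z p.
Proof. by rewrite dot_basis_coord; apply: eq_bigr => p pS; rewrite dot_interp. Qed.

Lemma interp_update_notin z i b :
  i \notin S -> interp [eta z with i |-> b] S = interp z S.
Proof.
move=> iS; apply: interp_unique => p pS; rewrite dot_interp //=.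
by case: eqP => // pi; rewrite -pi pS in iS.
Qed.

Lemma interp_update_in z i b : i \in S -> interp [eta z with i |-> b] S =
  interp z S + (b - z i) *: dual_basis S i.
Proof.
move=> iS; apply: interp_unique => p pS.
rewrite dotDl dotZl dot_dual_basis // dot_interp //=.
by case: eqP => [->|_]; rewrite ?mulr1 ?mulr0 ?addr0 // addrC subrK.
Qed.

End Basis.
End VectorFamilies.

Lemma general_position_oapp (R : realType) n (T : finType) (v : T -> 'rV[R]_n) y :
  general_position (oapp v y) -> general_position v.
Proof.
move=> vy_gen S cardS u uS; apply: (vy_gen (Some @: S)).
  by rewrite card_imset //; exact: Some_inj.
by move=> _ /imsetP[p pS ->]; exact: uS.
Qed.

Lemma sum_setU1_with (T : finType) (U : Type) (V : nmodType) (j : T) (B : {set T})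
    (F : T -> U -> V) (f : T -> U) (b : U) : j \notin B ->
  \sum_(p in j |: B) F p ([eta f with j |-> b] p) = F j b + \sum_(p in B) F p (f p).
Proof.
move=> jB; rewrite big_setU1 //= eqxx; congr (_ + _).
by apply: eq_bigr => p pB; case: eqP => // pj; rewrite -pj pB in jB.
Qed.

Section ConicHull.
Variables (R : realType) (n : nat) (T : finType).
Implicit Types (v : T -> 'rV[R]_n) (B Q : {set T}) (w l z : T -> R).
Implicit Types (x y u : 'rV[R]_n).

Definition conic_comb v Q w y : Prop :=
  (forall p, p \in Q -> 0 <= w p) /\ y = \sum_(p in Q) w p *: v p.

Definition conic_hull v Q : set 'rV[R]_n :=
  [set y | exists w, conic_comb v Q w y]%classic.

Lemma conic_hull_sub v Q Q' : Q \subset Q' ->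
  (conic_hull v Q `<=` conic_hull v Q')%classic.
Proof.
move=> QQ' y [w [w_ge0 yE]]; exists (fun p => if p \in Q then w p else 0).
split=> [p _|]; first by case: ifP => // /w_ge0.
rewrite yE [RHS](big_setID Q) (finset.setIidPr QQ') /= [X in _ + X]big1 => [|p].
  by rewrite addr0; apply: eq_bigr => p ->.
by rewrite inE => /andP[/negPf-> _]; rewrite scale0r.
Qed.

Lemma conic_hull_dot_le0 v Q y u : conic_hull v Q y ->
  (forall p, p \in Q -> dot u (v p) <= 0) -> dot u y <= 0.
Proof.
move=> [w [w_ge0 ->]] u_le0; rewrite dot_sumr; apply: sumr_le0 => p pQ.
by rewrite dotZr mulr_ge0_le0 ?w_ge0 ?u_le0.
Qed.

Definition proj_along e u x : 'rV[R]_n := x - (dot u x / dot u e) *: e.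

Lemma dot_proj_along e u u' x :
  dot u' (proj_along e u x) = dot (proj_along u e u') x.
Proof.
by rewrite dotBr dotBl dotZr dotZl (dotC e u) (dotC e u'); ring.
Qed.

Lemma proj_along_id e u : dot u e != 0 -> proj_along e u e = 0.
Proof. by move=> ue; rewrite /proj_along divff // scale1r subrr. Qed.

Lemma conic_hull_proj_along v B j u y : j \in B -> 0 < dot u (v j) ->
  (forall p, p \in B :\ j -> dot u (v p) <= 0) -> 0 <= dot u y ->
  conic_hull (proj_along (v j) u \o v) (B :\ j) (proj_along (v j) u y) ->
  conic_hull v B y.
Proof.
move=> jB uj uB uy [w [w_ge0 yE]]; pose a x := dot u x / dot u (v j).
pose b := a y - \sum_(p in B :\ j) w p * a (v p).
have b_ge0 : 0 <= b.
  rewrite subr_ge0; apply: (@le_trans _ _ 0); last by rewrite divr_ge0 // ltW.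
  apply: sumr_le0 => p pB; rewrite mulr_ge0_le0 ?w_ge0 //.
  by rewrite /a pmulr_lle0 ?uB // invr_gt0.
exists [eta w with j |-> b]; split=> [p pB /=|].
  by case: eqP => // /eqP pj; rewrite w_ge0 // !inE pj.
rewrite -[B](finset.setD1K jB).
rewrite (sum_setU1_with (fun p c => c *: v p)) ?setD11 //.
rewrite scalerBl scaler_suml -addrA [- _ + _]addrC -sumrB.
rewrite -[LHS](subrK (a y *: v j)) -/(proj_along _ _ _) yE addrC.
by congr (_ + _); apply: eq_bigr => p _; rewrite scalerBr scalerA.
Qed.

(* Induction on the number of vectors: if [u] separates [y] from all of them but
   [v j], project along [v j] onto the hyperplane orthogonal to [u]. *)
Lemma farkas v B y : conic_hull v B y \/
  exists2 u, (forall p, p \in B -> dot u (v p) <= 0) & 0 < dot u y.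
Proof.
elim: {B}#|B| {-2}B (erefl #|B|) v y => [|k IHk] B cardB v y.
  have B0 : B = finset.set0 by exact: cards0_eq.
  have [->|y0] := eqVneq y 0; last first.
    by right; exists y; [move=> p; rewrite B0 inE | rewrite dotxx_gt0].
  by left; exists (fun=> 0); split=> [p //|]; rewrite B0 big_set0.
have /card_gt0P[j jB] : (0 < #|B|)%N by rewrite cardB.
have cardBj : #|B :\ j| = k by move: (cardsD1 j B); rewrite jB cardB => -[].
have B_cases (P : T -> Prop) : P j -> (forall p, p \in B :\ j -> P p) ->
    forall p, p \in B -> P p.
  by move=> Pj PB p pB; have [->//|pj] := eqVneq p j; apply: PB; rewrite !inE pj.
have [yBj|[u u_le0 uy]] := IHk _ cardBj v y.
  by left; apply: conic_hull_sub yBj; exact: subD1set.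
have [uj|uj] := leP (dot u (v j)) 0; first by right; exists u => //; exact: B_cases.
pose proj := proj_along (v j) u.
have [yP|[u' u'_le0 u'y]] := IHk _ cardBj (proj \o v) (proj y).
  by left; apply: (conic_hull_proj_along jB uj u_le0 (ltW uy)).
right; exists (proj_along u (v j) u'); last by rewrite -dot_proj_along.
apply: B_cases => [|p pB]; last by rewrite -dot_proj_along u'_le0.
by rewrite -dot_proj_along proj_along_id ?gt_eqF // dotC dot0l.
Qed.

(* The ratio test of the simplex method: a conic combination is moved along a
   linear relation until the weight of some [p] vanishes. *)
Lemma ratio_test v Q w l z y : conic_comb v Q w y ->
  \sum_(p in Q) l p *: v p = 0 -> (exists2 p, p \in Q & 0 < l p) ->
  exists p w', [/\ p \in Q, 0 < l p, conic_comb v (Q :\ p) w' y &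
    \sum_(q in Q :\ p) w' q * z q =
      \sum_(q in Q) w q * z q - w p / l p * \sum_(q in Q) l q * z q].
Proof.
move=> [w_ge0 yE] l_rel [p0 p0Q lp0_gt0].
pose leaving := [pred p in Q | 0 < l p].
have p0_leaving : leaving p0 by rewrite /= p0Q.
case: (@arg_minP _ _ _ p0 leaving (fun p => w p / l p) p0_leaving).
move=> p /andP[pQ lp] pmin.
pose w' q := w q - w p / l p * l q.
have w'p : w' p = 0 by rewrite /w' divfK ?gt_eqF // subrr.
exists p, w'; split=> //; last first.
  rewrite mulr_sumr -sumrB [RHS](big_setD1 p) //= mulrA -mulrBl -/(w' p) w'p.
  by rewrite mul0r add0r; apply: eq_bigr => q _; rewrite mulrBl mulrA.
split=> [q|].
  rewrite !inE => /andP[_ qQ]; rewrite subr_ge0.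
  have [lq|lq] := ltP 0 (l q); first by rewrite -ler_pdivlMr ?pmin //= qQ.
  by apply: le_trans (w_ge0 q qQ); rewrite mulr_ge0_le0 // divr_ge0 ?w_ge0 // ltW.
have -> : y = \sum_(q in Q) w' q *: v q.
  under eq_bigr do rewrite scalerBl -scalerA.
  by rewrite sumrB -scaler_sumr l_rel scaler0 subr0.
by rewrite (big_setD1 p) //= w'p scale0r add0r.
Qed.

Lemma exists_weight_gt0 Q l z : (forall i, 0 < z i) ->
  0 <= \sum_(p in Q) l p * z p -> (exists2 p, p \in Q & l p != 0) ->
  exists2 p, p \in Q & 0 < l p.
Proof.
move=> z_pos lz_ge0 [p pQ lp]; apply: contrapT => npos.
have lz_le0 q : q \in Q -> 0 <= - (l q * z q).
  move=> qQ; rewrite oppr_ge0 pmulr_lle0 // leNgt; apply/negP => lq.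
  by apply: npos; exists q.
have sum0 : \sum_(q in Q) - (l q * z q) = 0.
  by apply/le_anti; rewrite sumr_ge0 // sumrN oppr_le0 lz_ge0.
have /eqP := psumr_eq0P lz_le0 sum0 pQ.
by rewrite oppr_eq0 mulf_eq0 (negPf lp) gt_eqF.
Qed.

End ConicHull.

Section FeasibleBases.
Variables (R : realType) (m : nat) (T : finType).
Variables (v : T -> 'rV[R]_m.+1) (y : 'rV[R]_m.+1).
Implicit Types (B Q S X : {set T}) (w l z : T -> R) (u : 'rV[R]_m.+1).

Definition feasible_bases B : {set {set T}} :=
  [set S : {set T} | [&& S \subset B, #|S| == m.+1 & `[< conic_hull v S y >]]].

Definition below z S : {set T} := [set i | z i < dot (interp v z S) (v i)].

Definition above z S : {set T} := [set i | dot (interp v z S) (v i) < z i].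

(* Positive heights bound the linear program
   [min (sum w z), sum w v = y, w >= 0] from below. *)
Definition generic_lift z : Prop :=
  (forall i, 0 < z i) /\
  (forall S i, #|S| = m.+1 -> i \notin S -> dot (interp v z S) (v i) != z i).

(* The points of [Q] outside [S] have positive reduced cost. *)
Definition optimal z Q S : bool :=
  (S \in feasible_bases Q) && (Q :\: S \subset above z S).

Lemma feasible_basesP B S :
  reflect [/\ S \subset B, #|S| = m.+1 & conic_hull v S y] (S \in feasible_bases B).
Proof.
rewrite inE; apply: (iffP and3P) => -[SB cardS yS]; split=> //.
all: by [exact/eqP | exact/asboolP].
Qed.

Lemma feasible_basesS B B' S : B \subset B' ->
  S \in feasible_bases B -> S \in feasible_bases B'.
Proof.
move=> BB' /feasible_basesP[SB cardS yS]; apply/feasible_basesP; split=> //.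
exact: fintype.subset_trans BB'.
Qed.

Hypothesis vy_gen : general_position (oapp v y).

Let v_gen : general_position v := general_position_oapp vy_gen.

Lemma orthogonal_eq0 S (t : option T) u : #|S| = m -> t \notin Some @: S ->
  (forall p, p \in S -> dot u (v p) = 0) -> dot u (oapp v y t) = 0 -> u = 0.
Proof.
move=> cardS tS uS ut; apply: (vy_gen (S := t |: Some @: S)).
  by rewrite cardsU1 tS card_imset ?cardS //; exact: Some_inj.
by move=> _ /setU1P[->//|/imsetP[p pS ->]]; exact: uS.
Qed.

Lemma basis_coord_neq0 S p (t : option T) : #|S| = m.+1 -> p \in S ->
  t \notin Some @: S -> basis_coord v S p (oapp v y t) != 0.
Proof.
move=> cardS pS tS; apply/eqP => coord0.
have dual0 : dual_basis v S p = 0.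
  apply: (orthogonal_eq0 (S := S :\ p) _ _ _ coord0).
  - by move: (cardsD1 p S); rewrite pS cardS => -[].
  - by apply: contra tS; apply/fintype.subsetP/imsetS/subD1set.
  - move=> q /setD1P[/negPf qp qS].
    by rewrite (dot_dual_basis cardS (v_gen cardS)) // qp.
have := dot_dual_basis cardS (v_gen cardS) p pS.
by rewrite dual0 dot0l eqxx => /eqP; rewrite eq_sym oner_eq0.
Qed.

Lemma feasible_coord_gt0 S p : #|S| = m.+1 -> conic_hull v S y -> p \in S ->
  0 < basis_coord v S p y.
Proof.
move=> cardS [w [w_ge0 yE]] pS; rewrite lt_neqAle eq_sym.
rewrite (basis_coord_neq0 (t := None) cardS pS); last by apply/imsetP => -[].
by rewrite yE (basis_coord_sum cardS (v_gen cardS)) // w_ge0.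
Qed.

Lemma below_notin z S i : #|S| = m.+1 -> i \in below z S -> i \notin S.
Proof.
move=> cardS; rewrite inE; apply: contraTN => iS.
by rewrite (dot_interp cardS (v_gen cardS)) // ltxx.
Qed.

Lemma in_above z S i : generic_lift z -> #|S| = m.+1 ->
  (i \in above z S) = (i \notin S) && (i \notin below z S).
Proof.
move=> [_ z_gen] cardS; rewrite !inE /=; have [iS|iS] := boolP (i \in S).
  by rewrite (dot_interp cardS (v_gen cardS)) // ltxx.
by rewrite -leNgt lt_neqAle z_gen.
Qed.

Lemma exists_feasible_basis_le Q w z : (forall i, 0 < z i) -> (m < #|Q|)%N ->
  conic_comb v Q w y ->
  exists2 S, S \in feasible_bases Q & dot (interp v z S) y <= \sum_(p in Q) w p * z p.
Proof.
move=> z_pos; elim: {Q}#|Q| {-2}Q w (erefl #|Q|) => [|k IHk] Q w cardQ.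
  by rewrite cardQ.
rewrite cardQ.
rewrite ltnS leq_eqVlt => /predU1P[mk|mk] yQ.
  have {mk}cardQ : #|Q| = m.+1 by rewrite cardQ mk.
  exists Q; first by apply/feasible_basesP; split=> //; exists w.
  rewrite (dot_interp_sum cardQ (v_gen cardQ)) yQ.2; apply: ler_sum => p pQ.
  by rewrite (basis_coord_sum cardQ (v_gen cardQ)).
have [|l l_rel lnz] := @exists_linear_relation _ _ _ v Q; first by rewrite cardQ.
wlog lz : l l_rel lnz / 0 <= \sum_(p in Q) l p * z p.
  move=> wlog_lz; have [|lz] := leP 0 (\sum_(p in Q) l p * z p); first exact: wlog_lz.
  apply: (wlog_lz (fun p => - l p)).
  - by under eq_bigr do rewrite scaleNr; rewrite sumrN l_rel oppr0.
  - by case: lnz => p pQ lp; exists p; rewrite // oppr_eq0.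
  - by under eq_bigr do rewrite mulNr; rewrite sumrN oppr_ge0 ltW.
have l_pos := exists_weight_gt0 z_pos lz lnz.
have [p [w' [pQ lp yQp costE]]] := ratio_test z yQ l_rel l_pos.
have cardQp : #|Q :\ p| = k by move: (cardsD1 p Q); rewrite pQ cardQ => -[].
have [|S SQp le_w'] := IHk _ w' cardQp _ yQp; first by rewrite cardQp.
exists S; first exact: feasible_basesS (subD1set _ _) SQp.
by apply: (le_trans le_w'); rewrite costE gerBl mulr_ge0 // divr_ge0 ?(yQ.1 p) // ltW.
Qed.

Lemma exists_pivot z S j : (forall i, 0 < z i) -> #|S| = m.+1 ->
  conic_hull v S y -> j \in below z S ->
  exists2 S', S' \in feasible_bases (j |: S) &
    dot (interp v z S') y < dot (interp v z S) y.
Proof.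
move=> z_pos cardS yS jb; have jS := below_notin cardS jb; have S_span := v_gen cardS.
pose w := [eta (basis_coord v S)^~ y with j |-> 0].
pose l := [eta (basis_coord v S)^~ (v j) with j |-> -1].
have yjS : conic_comb v (j |: S) w y.
  split=> [p /setU1P[->|pS] /=|]; first by rewrite eqxx.
    by case: eqP => // _; rewrite ltW // feasible_coord_gt0.
  rewrite (sum_setU1_with (fun p c => c *: v p)) // scale0r add0r.
  by rewrite (sum_basis_coord cardS S_span).
have costw : \sum_(p in j |: S) w p * z p = dot (interp v z S) y.
  rewrite (sum_setU1_with (fun p c => c * z p)) // mul0r add0r.
  by rewrite (dot_interp_sum cardS S_span).
have l_rel : \sum_(p in j |: S) l p *: v p = 0.
  rewrite (sum_setU1_with (fun p c => c *: v p)) // scaleN1r.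
  by rewrite (sum_basis_coord cardS S_span) addNr.
have lz : 0 < \sum_(p in j |: S) l p * z p.
  rewrite (sum_setU1_with (fun p c => c * z p)) // mulN1r addrC.
  by rewrite -(dot_interp_sum cardS S_span) subr_gt0; rewrite inE in jb.
have l_pos : exists2 p, p \in j |: S & 0 < l p.
  apply: exists_weight_gt0 z_pos (ltW lz) _.
  by exists j; rewrite ?setU11 //= eqxx oppr_eq0 oner_eq0.
have [p [w' [pjS lp yjSp costE]]] := ratio_test z yjS l_rel l_pos.
have pj : p != j by apply: contraTneq lp => ->; rewrite /= eqxx ltr0N1.
have pS : p \in S by move: pjS; rewrite !inE (negPf pj).
have card_jSp : (m < #|(j |: S) :\ p|)%N.
  by move: (cardsD1 p (j |: S)); rewrite pjS cardsU1 jS cardS; lia.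
have [S' S'jSp le_w'] := exists_feasible_basis_le z_pos card_jSp yjSp.
exists S'; first exact: feasible_basesS (subD1set _ _) S'jSp.
apply: (le_lt_trans le_w'); rewrite costE costw gtrBl mulr_gt0 // divr_gt0 //.
by rewrite /= (negPf pj) feasible_coord_gt0.
Qed.

Lemma exists_optimal Q z : generic_lift z -> (m < #|Q|)%N -> conic_hull v Q y ->
  exists S, optimal z Q S.
Proof.
move=> z_gen cardQ [w yQ]; have z_pos := z_gen.1.
have [S0 S0Q _] := exists_feasible_basis_le z_pos cardQ yQ.
case: (@arg_minP _ _ _ S0 (mem (feasible_bases Q)) (fun S => dot (interp v z S) y) S0Q).
move=> S SQ Smin; exists S; apply/andP; split=> //; apply/fintype.subsetP => j.
have /feasible_basesP[sSQ cardS yS] := SQ.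
move=> /setDP[jQ jS]; rewrite in_above // jS; apply/negP => jb.
have [S' S'jS] := exists_pivot z_pos cardS yS jb.
apply/negP; rewrite -leNgt Smin //=; apply: feasible_basesS S'jS.
by rewrite finset.subUset finset.sub1set jQ.
Qed.

Lemma optimal_value_lt Q z S S' : optimal z Q S -> S' \in feasible_bases Q ->
  S' != S -> dot (interp v z S) y < dot (interp v z S') y.
Proof.
case/andP=> /feasible_basesP[SQ cardS yS] S_above /feasible_basesP[S'Q cardS' yS'].
move=> neqS; have /subsetPn[p pS' pS] : ~~ (S' \subset S).
  by apply: contraNN neqS => S'S; rewrite eqEcard S'S cardS cardS' leqnn.
have lt_z q : q \in S' -> q \notin S -> dot (interp v z S) (v q) < z q.
  move=> qS' qS; have := fintype.subsetP S_above q; rewrite !inE qS.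
  by rewrite (fintype.subsetP S'Q) //; apply.
rewrite (dot_interp_sum cardS' (v_gen cardS')) (dot_basis_coord cardS' (v_gen cardS')).
rewrite [ltLHS](big_setD1 p) // [ltRHS](big_setD1 p) //=; apply: ltr_leD.
  by rewrite ltr_pM2l ?feasible_coord_gt0 ?lt_z.
apply: ler_sum => q /setD1P[_ qS']; rewrite ler_pM2l ?feasible_coord_gt0 //.
have [qS|qS] := boolP (q \in S); last by rewrite ltW ?lt_z.
by rewrite (dot_interp cardS (v_gen cardS)).
Qed.

Lemma optimal_unique Q z S S' : optimal z Q S -> optimal z Q S' -> S = S'.
Proof.
move=> Sopt S'opt; apply/eqP; apply: contraT => neqS.
have [/andP[SQ _] /andP[S'Q _]] := (Sopt, S'opt).
have := lt_trans (optimal_value_lt S'opt SQ neqS) (optimal_value_lt Sopt S'Q _).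
by rewrite eq_sym neqS ltxx => /(_ isT).
Qed.

Lemma conic_hull_card_gt B : (m <= #|T|)%N -> conic_hull v B y -> (m < #|B|)%N.
Proof.
move=> cardT [w [_ yE]]; rewrite ltnNge; apply/negP => cardB.
have [|S BS cardS] := exists_superset (B := B) (n := m); first by rewrite cardB.
have [|u u0 uS] := @exists_orthogonal _ _ _ v S; first by rewrite cardS.
case/eqP: u0; apply: (orthogonal_eq0 (t := None) cardS) => //.
  by apply/imsetP => -[].
rewrite /= yE dot_sumr big1 // => p /(fintype.subsetP BS) pS.
by rewrite dotZr uS ?mulr0.
Qed.

Definition feasible_below z B (k : nat) : {set {set T}} :=
  [set S in feasible_bases B | #|B :&: below z S| == k].

Lemma in_feasible_below z B k S : (S \in feasible_below z B k) =
  (S \in feasible_bases B) && (#|B :&: below z S| == k).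
Proof. exact: finset.in_set. Qed.

Definition faces B (j : nat) : {set {set T}} :=
  [set Q : {set T} | [&& Q \subset B, #|Q| == (m.+1 + j)%N & `[< conic_hull v Q y >]]].

Lemma card_below_above z B S : generic_lift z -> S \in feasible_bases B ->
  (#|B :&: below z S| + #|B :&: above z S| + m.+1 = #|B|)%N.
Proof.
move=> z_gen /feasible_basesP[SB cardS _].
have -> : B :&: below z S = (B :\: S) :&: below z S.
  apply/setP => i; rewrite !finset.in_setI finset.in_setD.
  by case: (boolP (i \in below z S)) => [/(below_notin cardS)->|]; rewrite ?andbF.
have -> : B :&: above z S = (B :\: S) :\: below z S.
  apply/setP => i; rewrite finset.in_setI !finset.in_setD in_above //.
  by rewrite andbC andbA [X in X && _]andbC.
by rewrite cardsID -cardS addnC -{1}(finset.setIidPr SB) cardsID.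
Qed.

Lemma disjoint_above z S : #|S| = m.+1 -> [disjoint S & above z S].
Proof.
move=> cardS; rewrite disjoint_subset; apply/fintype.subsetP => i iS.
by rewrite !inE (dot_interp cardS (v_gen cardS)) // ltxx.
Qed.

Lemma setUD_above z S X : #|S| = m.+1 -> X \subset above z S -> (S :|: X) :\: S = X.
Proof.
move=> cardS XA; rewrite finset.setDUl finset.setDv finset.set0U; apply/finset.setDidPl.
by rewrite disjoint_sym (disjointWr XA) ?disjoint_above.
Qed.

Lemma optimal_facesE z B S j : S \in feasible_bases B ->
  [set Q in faces B j | optimal z Q S] =
  [set S :|: X | X in [set X : {set T} | X \subset B :&: above z S & #|X| == j]].
Proof.
move=> /feasible_basesP[SB cardS yS]; apply/setP => Q; apply/idP/imsetP.
  rewrite !inE => /andP[/and3P[QB /eqP cardQ _] /andP[/feasible_basesP[SQ _ _] QS]].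
  exists (Q :\: S); last by rewrite -{1}(finset.setID Q S) (finset.setIidPr SQ).
  rewrite inE finset.subsetI QS cardsD (finset.setIidPr SQ) cardS cardQ addKn eqxx.
  by rewrite (fintype.subset_trans (subsetDl _ _) QB).
case=> X; rewrite inE finset.subsetI => /andP[/andP[XB XA] /eqP cardX] ->.
have /disjoint_setI0 SX := disjointWr XA (disjoint_above z cardS).
rewrite !inE finset.subUset SB XB cardsU SX cards0 subn0 cardS cardX eqxx /=.
apply/andP; split.
  by apply/asboolP; apply: conic_hull_sub yS; exact: finset.subsetUl.
apply/andP; split; first by apply/feasible_basesP; split=> //; exact: finset.subsetUl.
by rewrite (setUD_above cardS XA).
Qed.

Lemma card_optimal_faces z B S j : S \in feasible_bases B ->
  #|[set Q in faces B j | optimal z Q S]| = 'C(#|B :&: above z S|, j).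
Proof.
move=> SB; have /feasible_basesP[_ cardS _] := SB.
rewrite optimal_facesE // -cards_draws card_in_imset // => X X'.
rewrite !inE !finset.subsetI => /andP[/andP[_ XA] _] /andP[/andP[_ X'A] _] SX_eq.
by rewrite -(setUD_above cardS XA) SX_eq (setUD_above cardS X'A).
Qed.

(* Every face has exactly one optimal basis, so the binomial moments of the
   numbers of points above count the faces and do not depend on the lift. *)
Lemma sum_binomial_above z B j : generic_lift z ->
  (\sum_(S in feasible_bases B) 'C(#|B :&: above z S|, j) = #|faces B j|)%N.
Proof.
move=> z_gen.
under eq_bigr => S SB do rewrite -(card_optimal_faces _ _ SB).
rewrite sum_card_incidences -sum1_card; apply: eq_bigr => Q.
rewrite inE => /and3P[QB /eqP cardQ /asboolP yQ].
have [|S Sopt] := exists_optimal z_gen _ yQ; first by rewrite cardQ addSn ltnS leq_addr.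
apply/eqP/cards1P; exists S; apply/setP => S'; rewrite finset.in_set finset.in_set1.
apply/andP/eqP => [[_ S'opt]|->]; first exact: optimal_unique Sopt.
by split=> //; apply: feasible_basesS QB _; case/andP: Sopt.
Qed.

Lemma card_feasible_below_invariant z z' B k : generic_lift z -> generic_lift z' ->
  #|feasible_below z B k| = #|feasible_below z' B k|.
Proof.
move=> z_gen z'_gen.
pose above_counts z := [seq #|B :&: above z X| | X in feasible_bases B].
have countE zh : generic_lift zh -> #|feasible_below zh B k| =
    count (fun a => a + k + m.+1 == #|B|)%N (above_counts zh).
  move=> z1_gen; rewrite -sum1_count big_image_cond -sum1_card.
  apply: eq_bigl => S; rewrite inE; apply: andb_id2l => SB.
  by rewrite -(card_below_above z1_gen SB) eqn_add2r addnC eqn_add2r eq_sym.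
rewrite !countE //; apply/permP/perm_eq_binomial_moments => j.
by rewrite !big_image !sum_binomial_above.
Qed.

Lemma near_generic_lift_update z i : generic_lift z ->
  \forall M \near +oo, generic_lift [eta z with i |-> M].
Proof.
move=> [z_pos z_gen]; pose coord_i S j := basis_coord v S i (v j).
near=> M; have M_gt0 : 0 < M by near: M; exact/nbhs_pinfty_gt/num_real.
have M_gt_interp : forall S, dot (interp v z S) (v i) < M.
  by near: M; apply: filter_forall => S; exact/nbhs_pinfty_gt/num_real.
have M_gt_bad : forall S j, z i + (z j - dot (interp v z S) (v j)) / coord_i S j < M.
  by near: M; do 2![apply: filter_forall => ?]; exact/nbhs_pinfty_gt/num_real.
split=> [j /=|S j cardS jS]; first by case: eqP.
have S_span := v_gen cardS; have [iS|iS] := boolP (i \in S); last first.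
  rewrite interp_update_notin //=.
  by have [->|_] := eqVneq j i; [rewrite lt_eqF | exact: z_gen].
rewrite interp_update_in //= dotDl dotZl -/(coord_i S j).
rewrite ifN; last by apply: contraNneq jS => ->.
have coord_j : coord_i S j != 0.
  apply: (basis_coord_neq0 (t := Some j)) => //.
  by rewrite (mem_imset _ _ Some_inj).
apply/eqP => on_graph; have := M_gt_bad S j.
by rewrite -on_graph [_ + _ - _]addrC addKr mulfK // addrC subrK ltxx.
Unshelve. all: by end_near. Qed.

Lemma exists_high_lift z i : generic_lift z ->
  exists M, generic_lift [eta z with i |-> M] /\
    forall S, dot (interp v z S) (v i) < M.
Proof.
move=> z_gen; apply: (@filter_ex _ (pinfty_nbhs R)).
near=> M; split; first by near: M; exact: near_generic_lift_update.
by near: M; apply: filter_forall => S; exact/nbhs_pinfty_gt/num_real.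
Unshelve. all: by end_near. Qed.

Lemma feasible_basesD1 B S i :
  (S \in feasible_bases (B :\ i)) = (S \in feasible_bases B) && (i \notin S).
Proof.
by rewrite !inE subsetD1 [in RHS]andbC [RHS]andbA [X in X && _]andbC.
Qed.

(* [i] is lifted above all the hyperplanes through the other points. *)
Lemma leq_card_feasible_belowD1 z B i k : generic_lift z ->
  (#|feasible_below z (B :\ i) k| <= #|feasible_below z B k|)%N.
Proof.
move=> z_gen; have [M [z'_gen M_gt]] := exists_high_lift i z_gen.
rewrite (card_feasible_below_invariant B k z_gen z'_gen); apply: subset_leq_card.
apply/fintype.subsetP => S; rewrite !in_feasible_below feasible_basesD1.
case/andP=> /andP[SB iS] /eqP <-; rewrite SB /=; apply/eqP/eq_card => q.
have /feasible_basesP[_ cardS _] := SB.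
rewrite !inE (interp_update_notin cardS (v_gen cardS)) //=.
by case: eqP => //= ->; rewrite ltNge (ltW (M_gt S)) andbF.
Qed.

Lemma card_feasible_belowD1 z B i k : generic_lift z -> i \in B ->
  #|feasible_below z (B :\ i) k| =
  (#|[set S in feasible_below z B k.+1 | i \in below z S]| +
   #|[set S in feasible_below z B k | i \in above z S]|)%N.
Proof.
move=> z_gen iB; rewrite -(cardsID [set S | i \in below z S]).
have card_below S : #|B :&: below z S| =
    ((i \in below z S) + #|(B :\ i) :&: below z S|)%N.
  by rewrite (cardsD1 i) finset.in_setI iB finset.setIDAC.
congr (_ + _)%N; apply: eq_card => S.
  rewrite finset.in_setI [X in _ && X]finset.in_set [RHS]finset.in_set.
  rewrite !in_feasible_below feasible_basesD1 card_below.
  apply: andb_id2r => ib; rewrite ib -andbA; apply: andb_id2l.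
  by move=> /feasible_basesP[_ cardS _]; rewrite (below_notin cardS ib).
rewrite finset.in_setD [X in ~~ X]finset.in_set [RHS]finset.in_set andbC.
rewrite !in_feasible_below feasible_basesD1 card_below -!andbA.
apply: andb_id2l => /feasible_basesP[_ cardS _]; rewrite in_above //.
by case: (i \in below z S); rewrite ?andbF //= !andbT andbC.
Qed.

(* McMullen's recurrence: a double count of the pairs [(i, S)] with [i] outside
   the basis [S]. *)
Lemma sum_card_feasible_belowD1 z B k : generic_lift z ->
  (\sum_(i in B) #|feasible_below z (B :\ i) k| +
     (m.+1 + k) * #|feasible_below z B k| =
   k.+1 * #|feasible_below z B k.+1| + #|B| * #|feasible_below z B k|)%N.
Proof.
move=> z_gen; under eq_bigr => i iB do rewrite card_feasible_belowD1 //.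
rewrite big_split /= [X in (X + _ + _)%N]sum_card_incidences.
rewrite [X in (_ + X + _)%N]sum_card_incidences -addnA.
have setIin X : [set i in B | i \in X] = B :&: X by apply/setP => i; rewrite !inE.
congr (_ + _)%N.
  rewrite [RHS]mulnC -sum_nat_const; apply: eq_bigr => S.
  by rewrite in_feasible_below setIin => /andP[_ /eqP].
rewrite ![(_ * #|feasible_below z B k|)%N]mulnC -!sum_nat_const -big_split.
apply: eq_bigr => S /=; rewrite in_feasible_below setIin => /andP[SB /eqP belowS].
by rewrite -(card_below_above z_gen SB) belowS; lia.
Qed.

Lemma leq_card_feasible_belowS z B k : generic_lift z ->
  (k.+1 * #|feasible_below z B k.+1| <= (m.+1 + k) * #|feasible_below z B k|)%N.
Proof.
move=> z_gen; have := sum_card_feasible_belowD1 B k z_gen.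
have : (\sum_(i in B) #|feasible_below z (B :\ i) k| <=
        #|B| * #|feasible_below z B k|)%N.
  by rewrite -sum_nat_const; apply: leq_sum => i _; exact: leq_card_feasible_belowD1.
lia.
Qed.

Lemma in_feasible_below0 z B S : generic_lift z ->
  (S \in feasible_below z B 0) = optimal z B S.
Proof.
move=> z_gen; rewrite finset.in_set cards_eq0; apply: andb_id2l.
move=> /feasible_basesP[_ cardS _]; apply/eqP/fintype.subsetP => [below0 i|S_above].
  rewrite in_above // => /setDP[iB iS]; rewrite iS.
  by apply/negP => ib; have := finset.in_set0 i; rewrite -below0 finset.in_setI iB ib.
apply/setP => i; rewrite finset.in_setI finset.in_set0; apply/andP => -[iB ib].
have := S_above i; rewrite finset.in_setD iB in_above // ib.
by rewrite (below_notin cardS ib) => /(_ isT).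
Qed.

Lemma card_feasible_below0 z B : generic_lift z -> (#|feasible_below z B 0| <= 1)%N.
Proof.
move=> z_gen; apply/card_le1_eqP => S S'; rewrite !in_feasible_below0 //.
by move=> Sopt S'opt; rewrite (optimal_unique Sopt S'opt).
Qed.

Lemma card_feasible_below0_eq1 z B : generic_lift z -> (m <= #|T|)%N ->
  #|feasible_below z B 0| = 1%N <-> conic_hull v B y.
Proof.
move=> z_gen cardT; split=> [card1|yB].
  have /card_gt0P[S] : (0 < #|feasible_below z B 0|)%N by rewrite card1.
  rewrite in_feasible_below0 // => /andP[/feasible_basesP[SB _ yS] _].
  exact: conic_hull_sub SB _ yS.
have [S Sopt] := exists_optimal z_gen (conic_hull_card_gt cardT yB) yB.
apply/eqP; rewrite eqn_leq card_feasible_below0 //=.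
by apply/card_gt0P; exists S; rewrite in_feasible_below0.
Qed.

Theorem card_feasible_below_le z B k : generic_lift z ->
  (#|feasible_below z B k| <= 'C(m + k, k))%N.
Proof.
move=> z_gen; elim: k => [|k IHk]; first by rewrite bin0 card_feasible_below0.
rewrite -(leq_pmul2l (ltn0Sn k)) mul_binSr.
by apply: (leq_trans (leq_card_feasible_belowS B k z_gen)); rewrite leq_mul2l IHk orbT.
Qed.

Lemma card_feasible_below_maxS z B k : generic_lift z ->
  #|feasible_below z B k.+1| = 'C(m + k.+1, k.+1) <->
  #|feasible_below z B k| = 'C(m + k, k) /\
  forall i, i \in B -> #|feasible_below z (B :\ i) k| = 'C(m + k, k).
Proof.
move=> z_gen; have rec := sum_card_feasible_belowD1 B k z_gen.
set h := #|feasible_below z B k| in rec *.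
have D1_le i : i \in B -> (#|feasible_below z (B :\ i) k| <= h ?= iff
    (#|feasible_below z (B :\ i) k| == h))%N.
  by split=> //; exact: leq_card_feasible_belowD1.
have [sum_le sum_eq] := leqif_sum D1_le; rewrite sum_nat_const in sum_le sum_eq.
have h_le : ((m.+1 + k) * h <= (m.+1 + k) * 'C(m + k, k))%N.
  by rewrite leq_mul2l card_feasible_below_le ?orbT.
split=> [h_max|[h_max D1_max]].
  rewrite h_max mul_binSr in rec.
  have hC : h = 'C(m + k, k).
    by apply/eqP; rewrite -(@eqn_pmul2l (m.+1 + k)) //; apply/eqP; lia.
  split=> // i iB; rewrite -hC; apply/eqP; move: i iB; apply/forall_inP.
  by rewrite -sum_eq; apply/eqP; lia.
apply/eqP; rewrite -(eqn_pmul2l (ltn0Sn k)) mul_binSr -h_max; apply/eqP.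
have /eqP : (\sum_(i in B) #|feasible_below z (B :\ i) k| == #|B| * h)%N.
  by rewrite sum_eq; apply/forall_inP => i iB; rewrite D1_max // h_max.
lia.
Qed.

Definition deep B (k : nat) : Prop :=
  forall X, (#|X| <= k)%N -> conic_hull v (B :\: X) y.

Lemma deepS B k : deep B k.+1 <-> deep B k /\ forall i, i \in B -> deep (B :\ i) k.
Proof.
split=> [yB|[yB yBi] X cardX].
  split=> [X cardX|i iB X cardX]; first by apply: yB; exact: leqW.
  by rewrite finset.setDDl; apply: yB; rewrite cardsU1; lia.
have [XB|[i /setIP[iX iB]]] := set_0Vmem (X :&: B).
  have -> : B :\: X = B :\: finset.set0.
    by rewrite finset.setD0; apply/finset.setDidPl; rewrite -setI_eq0 finset.setIC XB.
  by apply: yB; rewrite cards0.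
have -> : B :\: X = (B :\ i) :\: (X :\ i) by rewrite finset.setDDl finset.setD1K.
by apply: yBi => //; move: (cardsD1 i X); rewrite iX; lia.
Qed.

Theorem card_feasible_below_eq z B k : generic_lift z -> (m <= #|T|)%N ->
  #|feasible_below z B k| = 'C(m + k, k) <-> deep B k.
Proof.
move=> z_gen cardT; elim: k B => [|k IHk] B.
  rewrite bin0; apply: (iff_trans (card_feasible_below0_eq1 B z_gen cardT)).
  split=> [yB X|/(_ finset.set0)]; last by rewrite finset.setD0 cards0; apply.
  by rewrite leqn0 cards_eq0 => /eqP->; rewrite finset.setD0.
apply: (iff_trans (card_feasible_below_maxS B k z_gen)).
apply: (iff_trans _ (iff_sym (deepS B k))).
by split=> -[/IHk h_max D1_max]; split=> // i /D1_max/IHk.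
Qed.

End FeasibleBases.

Local Open Scope fset_scope.
Local Open Scope ring_scope.

Section PowerOfPoint.
Variables (R : realType) (d : nat).
Implicit Types (p q c : 'rV[R]_d) (r s : R) (S A : {fset 'rV[R]_d}).

(* [s] is the squared radius. *)
Definition power c s p : R := dot (p - c) (p - c) - s.

Definition on_sphere c s S : Prop := forall p, p \in S -> power c s p = 0.

Lemma continuous_power c s : continuous (power c s).
Proof.
rewrite /power => p; apply: (@cvgB _ _ _ (nbhs p)); last exact: cvg_cst.
apply: (cvg_big add_continuous) => i _.
have coord_cvg : ((q - c) ord0 i @[q --> p] --> (p - c) ord0 i)%classic.
  apply: (cvg_comp (fun q => q - c) (fun M => M ord0 i)); last exact: coord_continuous.
  by apply: (@cvgB _ _ _ (nbhs p)); [exact: cvg_id | exact: cvg_cst].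
exact: cvgM.
Qed.

Lemma enorm_ge0 p : 0 <= enorm p.
Proof. exact: sqrtr_ge0. Qed.

Lemma enorm_sqr p : enorm p ^+ 2 = dot p p.
Proof. by rewrite sqr_sqrtr // dotxx_ge0. Qed.

Lemma sphereE c r p : 0 <= r -> sphere c r p <-> power c (r ^+ 2) p = 0.
Proof.
move=> r_ge0; rewrite /sphere /power /= -enorm_sqr.
split=> [->|/eqP]; first by rewrite subrr.
by rewrite subr_eq0 eqrXn2 ?enorm_ge0 // => /eqP.
Qed.

Lemma cballE c r p : 0 <= r -> cball c r p <-> power c (r ^+ 2) p <= 0.
Proof.
move=> r_ge0; rewrite /cball /power /= -enorm_sqr subr_le0.
by rewrite ler_pXn2r ?nnegrE ?enorm_ge0.
Qed.

Lemma interior_cballE c r p : 0 < r ->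
  interior (cball c r) p <-> power c (r ^+ 2) p < 0.
Proof.
move=> r_gt0; split=> [p_int|p_in]; last first.
  apply: filterS (cvgr_lt _ (@continuous_power c (r ^+ 2) p) _ p_in) => q /ltW.
  by move/cballE; apply; exact: ltW.
rewrite ltNge; apply/negP; rewrite subr_ge0 => p_out.
pose ray (t : R) := c + t *: (p - c).
have ray1 : ray 1 = p by rewrite /ray scale1r addrC subrK.
have ray_cvg : (ray t @[t --> (1 : R)] --> ray 1)%classic.
  by apply: cvgD; [exact: cvg_cst | exact: scalel_continuous].
have ray_in : \forall t \near (1 : R), cball c r (ray t).
  by apply: ray_cvg; rewrite ray1.
near ((1 : R)^'+)%classic => t.
have t_gt1 : 1 < t by near: t; exact: nbhs_right_gt.
have /(cballE _ _ (ltW r_gt0)) : cball c r (ray t) by near: t; exact: cvg_within ray_in.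
rewrite /power /ray [c + _]addrC addrK dotZl dotZr mulrA -expr2.
rewrite subr_le0 leNgt => /negP; apply.
apply: (le_lt_trans p_out); rewrite ltr_pMl ?exprn_egt1 //.
by apply: lt_le_trans p_out; rewrite exprn_gt0.
Unshelve. all: by end_near. Qed.

Lemma on_sphere_gt0 S c s : (1 < #|` S|)%N ->
  on_sphere c s S -> 0 < s.
Proof.
move=> cardS S_on; have sE p : p \in S -> s = dot (p - c) (p - c).
  by move=> /S_on/eqP; rewrite subr_eq0 => /eqP.
have [p pS] : exists p, p \in S by apply/fset0Pn; rewrite -cardfs_gt0 ltnW.
rewrite lt_neqAle {2}(sE p pS) dotxx_ge0 andbT; apply/eqP => s_eq0.
suff : S `<=` [fset c] by move/fsubset_leq_card; rewrite cardfs1 leqNgt cardS.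
by apply/fsubsetP => q /sE; rewrite -s_eq0 in_fset1 -subr_eq0 -dotxx_eq0 => <-.
Qed.

Lemma on_sphere_circumsphere S c s : (1 < #|` S|)%N ->
  on_sphere c s S -> circumsphere S c (Num.sqrt s).
Proof.
move=> cardS S_on; have s_gt0 := on_sphere_gt0 cardS S_on.
split=> [|p pS]; first by rewrite sqrtr_gt0.
by apply/(sphereE _ _ (sqrtr_ge0 s)); rewrite sqr_sqrtr ?(ltW s_gt0) ?S_on.
Qed.

Lemma points_insideE A c r : 0 < r ->
  points_inside A c r = [fset p in A | power c (r ^+ 2) p < 0].
Proof.
move=> r_gt0; apply/fsetP => p; rewrite !in_fset !inE /=; congr (_ && _).
by apply/asboolP/idP => /interior_cballE; apply.
Qed.

Lemma heftyP A k S : (0 < d)%N ->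
  hefty A k S <-> simplex_of A S /\ exists c s,
    on_sphere c s S /\ #|` [fset p in A | power c s p < 0]| = k.
Proof.
move=> d_gt0; split=> -[S_simplex].
  move=> [c [r [[r_gt0 S_sphere] inside_k]]]; split=> //; exists c, (r ^+ 2).
  by rewrite -points_insideE //; split=> // p /S_sphere/(sphereE _ _ (ltW r_gt0)).
move=> [c [s [S_on inside_k]]]; have [_ cardS _] := S_simplex.
have cardS_gt1 : (1 < #|` S|)%N by rewrite cardS ltnS.
split=> //; exists c, (Num.sqrt s).
have S_sphere := on_sphere_circumsphere cardS_gt1 S_on; split=> //.
rewrite (points_insideE _ _ S_sphere.1) sqr_sqrtr //.
exact: ltW (on_sphere_gt0 cardS_gt1 S_on).
Qed.

End PowerOfPoint.

Lemma card_imfset_set (I : finType) (K : choiceType) (f : I -> K) (X : {set I}) :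
  injective f -> #|` [fset f i | i in X]| = #|X|.
Proof. by move=> f_inj; rewrite card_imfset //= cardE. Qed.

Lemma sum_fsetval (K : choiceType) (V : nmodType) (A : {fset K}) (X : {set A})
    (f : K -> V) :
  \sum_(q <- [fsetval p in X]) f q = \sum_(p in X) f (val p).
Proof.
rewrite big_imfset /=; last by move=> p q _ _ /val_inj.
by rewrite big_enum.
Qed.

Section Homogenization.
Variables (R : realType) (d : nat).
Implicit Types (p q x u : 'rV[R]_d) (b : R) (A S : {fset 'rV[R]_d}).

Definition homog b p : 'rV[R]_d.+1 := row_mx (b%:M : 'M_1) p.

Lemma dot_homog a b p q : dot (homog a p) (homog b q) = a * b + dot p q.
Proof.
rewrite [LHS](@dot_row_mx R 1 d); congr (_ + _).
by rewrite /dot big_ord1 !mxE eqxx !mulr1n.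
Qed.

Lemma homog_surj (u : 'rV[R]_d.+1) : exists b p, u = homog b p.
Proof.
exists ((lsubmx (u : 'rV_(1 + d))) 0 0), (rsubmx (u : 'rV_(1 + d))).
by rewrite /homog -mx11_scalar hsubmxK.
Qed.

Lemma homog_inj a b p q : homog a p = homog b q -> a = b /\ p = q.
Proof.
by move=> /(@eq_row_mx R 1 1 d _ _ _ _)[/matrixP/(_ 0 0)]; rewrite !mxE eqxx !mulr1n.
Qed.

Lemma homog0 : homog 0 0 = 0.
Proof. by rewrite /homog raddf0 row_mx0. Qed.

Lemma homogZ a b p : a *: homog b p = homog (a * b) (a *: p).
Proof. by rewrite /homog -scale_scalar_mx; exact: (@scale_row_mx R 1 1 d a b%:M p). Qed.

Lemma homogD a b p q : homog a p + homog b q = homog (a + b) (p + q).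
Proof. by rewrite /homog raddfD; exact: (@add_row_mx R 1 1 d a%:M p b%:M q). Qed.

Lemma sum_homog (I : finType) (P : pred I) (w : I -> R) (f : I -> 'rV[R]_d) :
  \sum_(i | P i) w i *: homog 1 (f i) =
  homog (\sum_(i | P i) w i) (\sum_(i | P i) w i *: f i).
Proof.
elim/big_rec3: _ => [|i a b c _ ->]; first by rewrite homog0.
by rewrite homogZ homogD mulr1.
Qed.

Lemma conic_hull_homog A x (S : {set A}) :
  conic_hull (fun p : A => homog 1 (val p)) S (homog 1 x) <->
  conv [fsetval p in S] x.
Proof.
split=> [[w [w_ge0]]|[w [w_ge0 w_sum1 xE]]].
  rewrite sum_homog => /homog_inj[w_sum1 xE].
  pose w' q := oapp w 0 (insub q).
  have w'E (p : A) : w' (val p) = w p by rewrite /w' valK.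
  exists w'; split=> [q /in_fset_valP[qA qS]||].
  - by rewrite -[q]/(val [` qA]) w'E w_ge0.
  - by rewrite sum_fsetval w_sum1; apply: eq_bigr => p _; rewrite w'E.
  - by rewrite sum_fsetval xE; apply: eq_bigr => p _; rewrite w'E.
exists (fun p : A => w (val p)); split=> [p pS|]; first by rewrite w_ge0 ?val_in_fset.
by rewrite sum_homog xE -w_sum1 !sum_fsetval.
Qed.

Section GenericPoints.
Variable A : {fset 'rV[R]_d}.
Hypothesis A_gen : generic A.

Lemma generic_dot_constant S u b : S `<=` A -> #|` S| = d.+1 ->
  (forall p, p \in S -> dot u p = b) -> u = 0.
Proof.
move=> SA cardS uS; apply: contrapT => /eqP u0.
by apply: (A_gen.1 S SA cardS); exists u, b.
Qed.

Lemma generic_card_cosphere S c s : S `<=` A ->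
  on_sphere c s S -> #|` S| <> d.+2.
Proof.
move=> SA S_on cardS; apply: (A_gen.2 S SA cardS); exists c, (Num.sqrt s).
by apply: on_sphere_circumsphere; rewrite ?cardS.
Qed.

Lemma general_position_homog (I : finType) (f : I -> 'rV[R]_d) :
  injective f -> (forall i, f i \in A) -> general_position (fun i => homog 1 (f i)).
Proof.
move=> f_inj fA S cardS U; have [b [u ->]] := homog_surj U => US.
have u_const i : i \in S -> dot u (f i) = - b.
  by move=> /US/eqP; rewrite dot_homog mulr1 addrC addr_eq0 => /eqP.
have u0 : u = 0.
  apply: (@generic_dot_constant [fset f i | i in S] u (- b)).
  - by apply/fsubsetP => _ /imfsetP[i _ ->].
  - by rewrite card_imfset_set.
  - by move=> _ /imfsetP[i iS ->]; exact: u_const.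
have /card_gt0P[i /u_const] : (0 < #|S|)%N by rewrite cardS.
by rewrite u0 dot0l => /eqP; rewrite eq_sym oppr_eq0 => /eqP->; exact: homog0.
Qed.

Lemma general_position_sub (I : finType) (f : I -> 'rV[R]_d) a :
  injective f -> (forall i, f i \in A) -> a \in A -> (forall i, f i != a) ->
  general_position (fun i => f i - a).
Proof.
move=> f_inj fA aA fa S cardS u uS.
apply: (@generic_dot_constant (a |` [fset f i | i in S]) u (dot u a)).
- by rewrite fsubUset fsub1set aA; apply/fsubsetP => _ /imfsetP[i _ ->].
- rewrite cardfsU1 card_imfset_set // cardS; case: imfsetP => // -[i _ ai].
  by case/eqP: (fa i).
- move=> p /fset1UP[->//|/imfsetP[i /uS + ->]].
  by rewrite dotBr => /eqP; rewrite subr_eq0 => /eqP.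
Qed.

Lemma simplex_of_generic S : S `<=` A -> #|` S| = d.+1 -> simplex_of A S.
Proof.
move=> SA cardS; split=> // w; rewrite !big_seq_fsetE /= => w_sum0 wp_sum0 p pS.
pose v (q : S) := homog 1 (val q).
have v_gen : general_position v.
  by apply: general_position_homog => [|q]; [exact: val_inj | exact: fsubsetP (valP q)].
have cardT : #|[set: S]| = d.+1 by rewrite cardsT -cardfE.
have wE := basis_coord_sum cardT (v_gen _ cardT) (w \o val) (finset.in_setT [` pS]).
rewrite -[LHS]wE; under eq_bigl do rewrite inE.
by rewrite sum_homog w_sum0 wp_sum0 homog0 /basis_coord dotC dot0l.
Qed.

End GenericPoints.
End Homogenization.

Section SphereLift.
Variables (R : realType) (n m : nat) (F B : {fset 'rV[R]_n}).
Variables (v : B -> 'rV[R]_m.+1) (z : B -> R).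
Implicit Types (S : {set B}) (c : 'rV[R]_n) (s : R) (u : 'rV[R]_m.+1).

(* The spheres through [F] correspond to the linear forms [u], a point of [B]
   being inside the sphere if and only if its lift is below the graph of [u]. *)
Definition sphere_lift : Prop :=
  (forall c s, on_sphere c s F ->
     exists u, forall p, power c s (val p) = z p - dot u (v p)) /\
  (forall u, exists c s, on_sphere c s F /\
     forall p, power c s (val p) = z p - dot u (v p)).

Definition simplex_through S : {fset 'rV[R]_n} := F `|` [fsetval p in S].

Lemma simplex_through_sub S : simplex_through S `<=` F `|` B.
Proof. exact/fsetUS/fset_sub_val. Qed.

Hypotheses (FB : [disjoint F & B]) (cardF : (#|` F| + m)%N = n) (n_gt0 : (0 < n)%N).
Hypotheses (FB_gen : generic (F `|` B)) (v_gen : general_position v).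
Hypotheses (z_gt0 : forall p, 0 < z p) (vz : sphere_lift).

Lemma card_simplex_through S : #|` simplex_through S| = (#|` F| + #|S|)%N.
Proof.
rewrite cardfsU (_ : _ `&` _ = fset0) ?cardfs0 ?subn0.
  by rewrite card_imfset_set //; exact: val_inj.
apply/eqP; rewrite fsetI_eq0.
by apply: fdisjointWr FB; exact: fset_sub_val.
Qed.

Lemma on_sphere_simplex_through S c s u :
  on_sphere c s F ->
  (forall p, power c s (val p) = z p - dot u (v p)) ->
  (forall p, p \in S -> dot u (v p) = z p) ->
  on_sphere c s (simplex_through S).
Proof.
move=> F_on uE uS q /fsetUP[/F_on//|/imfsetP[p pS ->]].
by rewrite uE uS ?subrr.
Qed.

Lemma generic_sphere_lift : generic_lift v z.
Proof.
split=> // S i cardS iS; apply/eqP => i_on_graph.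
have [c [s [F_on uE]]] := vz.2 (interp v z S).
have iS_on : on_sphere c s (simplex_through (i |: S)).
  apply: (on_sphere_simplex_through F_on uE) => p /setU1P[->//|pS].
  exact: (dot_interp cardS (v_gen cardS)).
apply: (generic_card_cosphere FB_gen (simplex_through_sub _) iS_on).
by rewrite card_simplex_through cardsU1 iS cardS add1n !addnS cardF.
Qed.

Lemma inside_simplex_through S c s : #|S| = m.+1 ->
  on_sphere c s (simplex_through S) ->
  [fset q in F `|` B | power c s q < 0] = [fsetval p in below v z S].
Proof.
move=> cardS S_on; have F_on q : q \in F -> power c s q = 0.
  by move=> qF; rewrite S_on // in_fsetU qF.
have [u uE] := vz.1 c s F_on.
have {}uE p : power c s (val p) = z p - dot (interp v z S) (v p).
  rewrite uE; congr (_ - dot _ _).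
  apply/esym/(interp_unique cardS (v_gen cardS)) => q qS.
  by apply/esym/eqP; rewrite -subr_eq0 -uE S_on // in_fsetU val_in_fset qS orbT.
apply/fsetP => q; rewrite in_fset inE /=; apply/andP/in_fset_valP => [[]|[qB]].
  case/fsetUP=> [/F_on->|qB]; first by rewrite ltxx.
  by rewrite -[q]/(val [` qB]) uE subr_lt0; exists qB; rewrite finset.in_set.
rewrite finset.in_set -subr_lt0 -uE => q_inside.
by rewrite in_fsetU qB orbT.
Qed.

Lemma hefty_simplex_through k S : #|S| = m.+1 ->
  hefty (F `|` B) k (simplex_through S) <-> #|below v z S| = k.
Proof.
move=> cardS; have card_below : #|` [fsetval p in below v z S]| = #|below v z S|.
  by rewrite card_imfset_set //; exact: val_inj.
split=> [/(heftyP _ _ _ n_gt0)[_ [c [s [S_on]]]]|inside_k].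
  by rewrite (inside_simplex_through cardS S_on) card_below.
apply/heftyP => //; split.
  apply: simplex_of_generic (simplex_through_sub S) _ => //.
  by rewrite card_simplex_through cardS addnS cardF.
have [c [s [F_on uE]]] := vz.2 (interp v z S); exists c, s.
have S_on : on_sphere c s (simplex_through S).
  apply: (on_sphere_simplex_through F_on uE) => p.
  exact: (dot_interp cardS (v_gen cardS)).
by rewrite (inside_simplex_through cardS S_on) card_below.
Qed.

End SphereLift.

Lemma oapp_val_inj (K : choiceType) (A : {fset K}) x :
  x \notin A -> injective (oapp (val : A -> K) x).
Proof.
move=> x_notin [p|] [q|] //= => [/val_inj->//|val_eq|val_eq].
  by rewrite -val_eq (valP p) in x_notin.
by rewrite val_eq (valP q) in x_notin.
Qed.

Lemma generic_wrtW (R : realType) d (A : {fset 'rV[R]_d}) x :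
  generic_wrt A x -> generic A.
Proof.
move=> [_ [A_hyp A_sph]].
by split=> S SA; [apply: A_hyp | apply: A_sph]; exact: fsubset_trans (fsubsetU1 x A).
Qed.

Section Hull.
Variables (R : realType) (d : nat) (A : {fset 'rV[R]_d}) (x : 'rV[R]_d).
Implicit Types (u : 'rV[R]_d) (b : R).

Lemma hullP k : hull A k x <-> forall u b, u != 0 ->
  (#|[set p : A | (b < dot u (val p))%R]| <= k)%N -> dot u x <= b.
Proof.
have missE u b : #|` [fset p in A | p \notin [set q | dot u q <= b]%classic]| =
    #|[set p : A | (b < dot u (val p))%R]|.
  rewrite -(card_imfset_set _ val_inj); congr #|` _|; apply/fsetP => q.
  rewrite in_fset inE /=; apply/andP/in_fset_valP => [[qA]|[qA]].
    by rewrite notin_setE /= => /negP; rewrite -ltNge => bq; exists qA; rewrite /= inE.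
  by rewrite /= inE notin_setE /= => bq; split=> //; apply/negP; rewrite -ltNge.
split=> [x_hull u b u0 ub|x_hull H [[u [b [u0 ->]]] H_misses]].
  apply: (x_hull [set q | dot u q <= b]%classic).
  by split; [exists u, b | rewrite missE].
by rewrite /=; apply: x_hull => //; rewrite -missE.
Qed.

Lemma hull_card_gt k : (0 < d)%N -> hull A k x -> (k < #|` A|)%N.
Proof.
move=> d_gt0 /hullP x_hull; rewrite ltnNge; apply/negP => Ak.
pose u : 'rV[R]_d := const_mx 1.
have : dot u x <= dot u x - 1.
  apply: x_hull; last by rewrite (leq_trans (max_card _)) -?cardfE.
  by apply/eqP => /rowP/(_ (Ordinal d_gt0)); rewrite !mxE; exact/eqP/oner_neq0.
by rewrite lerBrDr gerDl ler10.
Qed.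

End Hull.

Section Paraboloid.
Variables (R : realType) (d : nat) (A : {fset 'rV[R]_d}) (x : 'rV[R]_d).
Hypotheses (d_gt0 : (0 < d)%N) (x_gen : generic_wrt A x).
Implicit Types (S X : {set A}) (u c : 'rV[R]_d) (b s : R).

Let v (p : A) := homog 1 (val p).
(* The summand [1] makes the heights positive, even at the origin. *)
Let z (p : A) : R := dot (val p) (val p) + 1.

Lemma general_position_paraboloid : general_position (oapp v (homog 1 x)).
Proof.
have [x_notin xA_gen] := x_gen.
have -> : oapp v (homog 1 x) = fun t => homog 1 (oapp val x t).
  by apply/funext => -[].
apply: (general_position_homog xA_gen); first exact: oapp_val_inj.
by move=> [p|] /=; rewrite in_fset1U ?eqxx ?(valP p) ?orbT.
Qed.

Lemma power_homog c s p : power c s p =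
  dot p p + 1 - dot (homog (s - dot c c + 1) (2 *: c)) (homog 1 p).
Proof. by rewrite /power dotBB dot_homog dotZl; ring. Qed.

Lemma sphere_lift_paraboloid : sphere_lift fset0 v z.
Proof.
split=> [c s _|U].
  by exists (homog (s - dot c c + 1) (2 *: c)) => p; exact: power_homog.
have [b [u ->]] := homog_surj U; pose c := 2^-1 *: u.
exists c, (b - 1 + dot c c); split=> [p|p]; first by rewrite in_fset0.
by rewrite power_homog scalerA divff ?pnatr_eq0 // scale1r addrK subrK.
Qed.

Let y_gen := general_position_paraboloid.
Let v_gen := general_position_oapp y_gen.

Let z_gt0 p : 0 < z p.
Proof. by rewrite ltr_wpDl ?dotxx_ge0. Qed.

Let A_disj : [disjoint fset0 & A].
Proof. exact: fdisjoint0X. Qed.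

Let A_card : (#|` (fset0 : {fset 'rV[R]_d})| + d)%N = d.
Proof. by rewrite cardfs0. Qed.

Let A_gen : generic (fset0 `|` A).
Proof. by rewrite fset0U; exact: generic_wrtW x_gen. Qed.

Lemma generic_paraboloid : generic_lift v z.
Proof.
exact: (generic_sphere_lift A_disj A_card A_gen v_gen z_gt0 sphere_lift_paraboloid).
Qed.

Lemma hefty_fsetval k S : #|S| = d.+1 ->
  hefty A k [fsetval p in S] <-> #|below v z S| = k.
Proof.
move=> cardS; rewrite -[A in hefty A]fset0U -[[fsetval p in S]]fset0U.
exact: (hefty_simplex_through A_disj A_card d_gt0 A_gen v_gen sphere_lift_paraboloid).
Qed.

Lemma in_feasible_below_paraboloid k S :
  (S \in feasible_below v (homog 1 x) z [set: A] k) =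
  `[< hefty A k [fsetval p in S] /\ conv [fsetval p in S] x >].
Proof.
rewrite in_feasible_below finset.setTI; apply/andP/asboolP => [[]|[S_hefty Sx]].
  move=> /feasible_basesP[_ cardS /conic_hull_homog Sx] /eqP belowS.
  by split=> //; apply/hefty_fsetval.
have cardS : #|S| = d.+1.
  case: S_hefty => -[_ + _] _; rewrite card_imfset_set //; exact: val_inj.
split; last by apply/eqP/hefty_fsetval.
by apply/feasible_basesP; split=> //; apply/conic_hull_homog.
Qed.

Lemma card_hefty_paraboloid k : #|` hefty_simplices_containing A k x| =
  #|feasible_below v (homog 1 x) z [set: A] k|.
Proof.
have fsetval_inj : injective (fun S : {set A} => [fsetval p in S]).
  by move=> S S' val_eq; rewrite -[S]FSetK -[S']FSetK val_eq.
rewrite -[RHS](card_imfset_set _ fsetval_inj); congr #|` _|; apply/fsetP => S.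
rewrite in_fset inE /= fpowersetE; apply/andP/imfsetP => [[SA S_hefty]|[S' /= S'b ->]].
  by exists (fsub A S); rewrite /= ?in_feasible_below_paraboloid fsubK.
by rewrite fset_sub_val -in_feasible_below_paraboloid.
Qed.

Lemma hull_of_deep k : deep v (homog 1 x) [set: A] k -> hull A k x.
Proof.
move=> x_deep; apply/hullP => u b u0 /x_deep x_hull.
have := conic_hull_dot_le0 (u := homog (- b) u) x_hull.
rewrite dot_homog mulr1 addrC subr_le0; apply=> p.
by rewrite !inE andbT -leNgt dot_homog mulr1 addrC subr_le0.
Qed.

Lemma deep_of_hull k : hull A k x -> deep v (homog 1 x) [set: A] k.
Proof.
move=> x_hull X Xk; have [//|[U]] := farkas v ([set: A] :\: X) (homog 1 x).
have [b [u ->]] := homog_surj U => U_le0; rewrite dot_homog mulr1 => x_gt0.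
have u_le p : p \notin X -> dot u (val p) <= - b.
  by move=> pX; have := U_le0 p; rewrite !inE pX dot_homog mulr1 => /(_ isT); lra.
have [u0|u0] := eqVneq u 0; last first.
  suff : dot u x <= - b by lra.
  move/hullP: x_hull; apply=> //; apply: leq_trans Xk; apply: subset_leq_card.
  by apply/fintype.subsetP => p; rewrite inE ltNge; apply: contraNT => /u_le.
have /card_gt0P[p] : (0 < #|~: X|)%N.
  rewrite cardsCs finset.setCK subn_gt0; apply: leq_ltn_trans Xk _.
  by rewrite -cardfE; exact: hull_card_gt x_hull.
by move: x_gt0; rewrite inE u0 dot0l => b_gt0 /u_le; rewrite u0 dot0l; lra.
Qed.

Lemma card_hefty_le k : (#|` hefty_simplices_containing A k x| <= 'C(d + k, k))%N.
Proof.
rewrite card_hefty_paraboloid.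
exact: (card_feasible_below_le y_gen _ _ generic_paraboloid).
Qed.

Lemma card_hefty_eq k : (d <= #|` A|)%N ->
  #|` hefty_simplices_containing A k x| = 'C(d + k, k) <-> hull A k x.
Proof.
rewrite cardfE => dA; rewrite card_hefty_paraboloid.
apply: (iff_trans (card_feasible_below_eq y_gen _ _ generic_paraboloid dA)).
by split=> [/hull_of_deep|/deep_of_hull].
Qed.

End Paraboloid.

Section VertexFigure.
Variables (R : realType) (d : nat) (A : {fset 'rV[R]_d.+1}) (a x : 'rV[R]_d.+1).
Hypotheses (aA : a \in A) (x_gen : generic_wrt A x).

Let B := A `\ a.
Let v (p : B) := val p - a.
Let z (p : B) : R := dot (val p - a) (val p - a).

Lemma general_position_vertex_figure : general_position (oapp v (x - a)).
Proof.
have [x_notin xA_gen] := x_gen.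
have -> : oapp v (x - a) = fun t => oapp val x t - a by apply/funext => -[].
apply: (general_position_sub xA_gen).
- by apply: oapp_val_inj; rewrite in_fsetD1 (negPf x_notin) andbF.
- move=> [p|] /=; rewrite in_fset1U ?eqxx //.
  by have /fsetD1P[_ ->] := valP p; rewrite orbT.
- by rewrite in_fset1U aA orbT.
- move=> [p|] /=; first by have /fsetD1P[] := valP p.
  by apply: contraNneq x_notin => ->.
Qed.

Lemma power_through c s p : power c s a = 0 ->
  power c s p = dot (p - a) (p - a) - dot (2 *: (c - a)) (p - a).
Proof. by rewrite /power !dotBB !dotZl !dotBl !dotBr (dotC a p); lra. Qed.

Lemma sphere_lift_vertex_figure : sphere_lift [fset a] v z.
Proof.
split=> [c s /(_ a (fset11 a)) a_on|u].
  by exists (2 *: (c - a)) => p; exact: power_through.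
pose c := a + 2^-1 *: u; pose s := dot (a - c) (a - c).
have a_on : power c s a = 0 by rewrite /power subrr.
exists c, s; split=> [p /fset1P->//|p].
rewrite (power_through _ a_on) /c [a + _]addrC addrK scalerA.
by rewrite divff ?pnatr_eq0 // scale1r.
Qed.

Let y_gen := general_position_vertex_figure.
Let v_gen := general_position_oapp y_gen.

Let z_gt0 p : 0 < z p.
Proof. by rewrite dotxx_gt0 subr_eq0; have /fsetD1P[] := valP p. Qed.

Let aB_disj : [disjoint [fset a] & B].
Proof. by rewrite fdisjoint1X in_fsetD1 eqxx. Qed.

Let aB_card : (#|` [fset a]| + d)%N = d.+1.
Proof. by rewrite cardfs1. Qed.

Let aB_gen : generic ([fset a] `|` B).
Proof. by rewrite fsetD1K //; exact: generic_wrtW x_gen. Qed.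

Lemma generic_vertex_figure : generic_lift v z.
Proof.
exact: (generic_sphere_lift aB_disj aB_card aB_gen v_gen z_gt0
         sphere_lift_vertex_figure).
Qed.

Lemma conv_vertex_figure (S : {set B}) :
  conv (simplex_through [fset a] S) x -> conic_hull v S (x - a).
Proof.
have aS : a \notin [fsetval p in S].
  by rewrite in_fset_valF // in_fsetD1 eqxx.
move=> [w [w_ge0 w_sum1 xE]]; exists (w \o val); split=> [p pS|] /=.
  by rewrite w_ge0 // in_fset1U val_in_fset pS orbT.
rewrite -(sum_fsetval S (fun q => w q *: (q - a))).
transitivity (\sum_(q <- simplex_through [fset a] S) w q *: (q - a)).
  under eq_bigr do rewrite scalerBr.
  by rewrite sumrB -scaler_suml w_sum1 scale1r -xE.
by rewrite big_fsetU1 //= subrr scaler0 add0r.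
Qed.

Lemma hefty_vertex_figure k S :
  S \in hefty_simplices_containing A k x -> a \in S ->
  exists2 X : {set B}, X \in feasible_below v (x - a) z [set: B] k &
    S = simplex_through [fset a] X.
Proof.
rewrite in_fset inE /= => /andP[_ /asboolP[S_hefty Sx]] aS.
have [[SA cardS _] _] := S_hefty.
have SE : S = simplex_through [fset a] (fsub B (S `\ a)).
  by rewrite /simplex_through fsubK ?fsetSD // fsetD1K.
exists (fsub B (S `\ a)) => //.
have cardX : #|fsub B (S `\ a)| = d.+1.
  by rewrite card_fsub ?fsetSD //; move: cardS; rewrite (cardfsD1 a) aS => -[].
rewrite in_feasible_below finset.setTI; apply/andP; split.
  by apply/feasible_basesP; split=> //; apply: conv_vertex_figure; rewrite -SE.
apply/eqP; move: S_hefty; rewrite -[A in hefty A](fsetD1K aA) {1}SE.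
by move/(hefty_simplex_through aB_disj aB_card (ltn0Sn d) aB_gen v_gen
           sphere_lift_vertex_figure k cardX).
Qed.

Lemma card_hefty_vertex_le k :
  (#|` [fset S in hefty_simplices_containing A k x | a \in S]| <= 'C(d + k, k))%N.
Proof.
pose stars := [fset simplex_through [fset a] X
                 | X in feasible_below v (x - a) z [set: B] k].
have sub_stars : [fset S in hefty_simplices_containing A k x | a \in S] `<=` stars.
  apply/fsubsetP => S; rewrite in_fset inE /= => /andP[S_hefty aS].
  by have [X Xk ->] := hefty_vertex_figure S_hefty aS; apply/imfsetP; exists X.
apply: (leq_trans (fsubset_leq_card sub_stars)).
apply: (leq_trans (leq_imfset_card _ _ _)); rewrite /= -cardE.
exact: (card_feasible_below_le y_gen _ _ generic_vertex_figure).
Qed.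

End VertexFigure.

(* The guard d <= #|` A| excludes sets A with fewer than d points, for which
   the equality criterion fails: genericity is then vacuous, there are no
   simplices, and x may still lie in the hull (d = 3, k = 0, A a pair of points
   and x their midpoint). *)
Theorem theorem4 (R : realType) (d : nat) (hd : (1 <= d)%N)
    (A : {fset 'rV[R]_d}) (hA : generic A) (k : nat)
    (a : 'rV[R]_d) (ha : a \in A) :
  (forall x : 'rV[R]_d, generic_wrt A x ->
     (#|` hefty_simplices_containing A k x| <= 'C(d + k, d))%N /\
     ((d <= #|` A|)%N ->
      (#|` hefty_simplices_containing A k x| = 'C(d + k, d) <-> hull A k x))) /\
  (exists eps : R, 0 < eps /\
     forall x : 'rV[R]_d, generic_wrt A x -> enorm (x - a) < eps ->
       (#|` [fset S in hefty_simplices_containing A k x | a \in S]|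
          <= 'C(d + k - 1, d - 1))%N).
Proof.
have binE n : 'C(n + k, n) = 'C(n + k, k) by rewrite -bin_sub ?leq_addr // addKn.
split=> [x x_gen|].
  by rewrite binE; split; [exact: card_hefty_le | exact: card_hefty_eq].
(* A simplex with vertex [a] that contains [x] also contains the points of the
   segment [a, x] close to [a], so the bound holds for all [x]. *)
exists 1; split=> // x x_gen _.
case: d hd A hA a ha x x_gen => // d _ A _ a aA x x_gen.
by rewrite addSn !subSS !subn0 binE; exact: card_hefty_vertex_le.
Qed.
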